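(* Let $n \geq 1$ be an integer, let $k = 3$ and $r = 2^n - 1$, and let $A = (a_{ij})_{i,j\in\mathbb{N}}$ be the naive matrix of Type $(k,r) = (3, 2^n-1)$. Denote $$d = \frac{(2^{n+1}-1)(2^n-1)}{3}.$$ Then each of the first $d$ rows of $A$ is of the form $\{a, b, a\oplus b\}$, where $0 < a < b < a \oplus b < 2^{n+1}$; that is, for every $i \in \{1,\dots,d\}$ there exist integers $a,b$ with $0 < a < b < a\oplus b < 2^{n+1}$ and $\{ j \in \mathbb{N} : a_{ij} = 1\} = \{a, b, a\oplus b\}$.
   Context: $\mathbb{N} = \{1,2,3,\dots\}$. For $k, r \in \mathbb{N}$, the naive matrix of Type $(k,r)$ is the unique $\mathbb{N}\times\mathbb{N}$-matrix $A = (a_{ij})_{i,j\in\mathbb{N}}$ with entries in $\{0,1\}$ such that $a_{ij} = 1$ if and only if none of the following three conditions holds: (i) there exist $i' < i$ and $j' < j$ such that $a_{i,j'} = a_{i',j} = a_{i',j'} = 1$; (ii) $\sum_{j'<j} a_{i,j'} \geq k$; (iii) $\sum_{i'<i} a_{i',j} \geq r$. (Sums are of integers.) The $i$-th row of $A$ is identified with its support $\{ j \in \mathbb{N} : a_{ij} = 1\}$. The symbol $\oplus$ denotes Nim addition on the non-negative integers, i.e. addition of binary expansions digitwise modulo 2 without carry (bitwise XOR). *)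

(* Defs.v *)
From Stdlib Require Import PeanoNat.
From mathcomp Require Import all_boot.
Set Implicit Arguments.
Unset Strict Implicit.
Unset Printing Implicit Defensive.

(* A {0,1}-matrix indexed by the positive integers is a map               *)
(* A : nat -> nat -> bool; only the entries A i j with 0 < i and 0 < j are *)
(* meaningful, so every index below is explicitly required to be positive. *)
Definition naive_obstruction (k r : nat) (A : nat -> nat -> bool) (i j : nat)
    : Prop :=
  [\/ exists i' j', [/\ 0 < i' < i, 0 < j' < j, A i j', A i' j & A i' j'],
      k <= \sum_(1 <= j' < j) A i j'
    | r <= \sum_(1 <= i' < i) A i' j].

Definition naive_matrix (k r : nat) (A : nat -> nat -> bool) : Prop :=
  forall i j, 0 < i -> 0 < j -> A i j <-> ~ naive_obstruction k r A i j.

Definition row_support (A : nat -> nat -> bool) (i : nat) : pred nat :=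
  [pred j | (0 < j) && A i j].

(* The naive matrix exists and its meaningful entries are determined, so   *)
(* quantifying over the A with naive_matrix k r A is speaking of "the"     *)
(* naive matrix of type (k, r).                                            *)
Section ExistenceUniqueness.
Variables k r : nat.
Implicit Types (A B : nat -> nat -> bool).

Definition naive_step A (i j : nat) : bool :=
  ~~ [|| [exists i' : 'I_i, [exists j' : 'I_j,
            [&& 0 < i', 0 < j', A i j', A i' j & A i' j']]],
         k <= \sum_(1 <= j' < j) A i j'
       | r <= \sum_(1 <= i' < i) A i' j].

Lemma naive_stepP A i j :
  reflect (~ naive_obstruction k r A i j) (naive_step A i j).
Proof.
apply: (iffP negP) => nH H; apply: nH.
- case: H => [[i' [j' [/andP[i0 ii] /andP[j0 jj] h1 h2 h3]]]|->|->];
    rewrite ?orbT //.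
  apply/orP; left; apply/existsP; exists (Ordinal ii).
  by apply/existsP; exists (Ordinal jj); apply/and5P.
- case/or3P: H => [/existsP[i' /existsP[j' /and5P[i0 j0 h1 h2 h3]]]|h|h].
  + by apply: Or31; exists i', j'; rewrite i0 j0 !ltn_ord.
  + exact: Or32.
  + exact: Or33.
Qed.

Lemma eq_naive_step A B i j : 0 < i -> 0 < j ->
  (forall i' j', 0 < i' -> 0 < j' -> i' + j' < i + j -> A i' j' = B i' j') ->
  naive_step A i j = naive_step B i j.
Proof.
move=> i0 j0 AB; congr (~~ [|| _, _ | _]).
- apply: eq_existsb => i'; apply: eq_existsb => j'.
  case i'0: (0 < i') => //=; case j'0: (0 < j') => //=.
  by rewrite !AB ?ltn_add2l ?ltn_add2r // -addSn leq_add // ltnW.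
- congr (_ <= _); apply: eq_big_nat => j' /andP[j'0 lej].
  by rewrite AB // ltn_add2l.
- congr (_ <= _); apply: eq_big_nat => i' /andP[i'0 lei].
  by rewrite AB // ltn_add2r.
Qed.

Lemma naive_matrix_uniq A B : naive_matrix k r A -> naive_matrix k r B ->
  forall i j, 0 < i -> 0 < j -> A i j = B i j.
Proof.
move=> nA nB i j; have [m] := ubnP (i + j).
elim: m i j => // m IH i j; rewrite ltnS => lem i0 j0.
have E C : naive_matrix k r C -> C i j = naive_step C i j.
  by move=> nC; apply/idP/naive_stepP => /(nC i j i0 j0).
rewrite (E A) // (E B) //; apply: eq_naive_step => // i' j' i'0 j'0 lt.
by apply: IH => //; apply: leq_trans lt lem.
Qed.

Lemma naive_matrix_exists : exists A, naive_matrix k r A.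
Proof.
pose it m := iter m naive_step (fun _ _ => false).
have stable m m' i j : 0 < i -> 0 < j -> i + j < m -> i + j < m' ->
    it m i j = it m' i j.
  elim: m m' i j => // m IH [//|m'] i j i0 j0; rewrite !ltnS => lem lem'.
  apply: eq_naive_step => // i' j' i'0 j'0 lt.
  by apply: IH => //; [apply: leq_trans lt lem | apply: leq_trans lt lem'].
exists (fun i j => it (i + j).+1 i j) => i j i0 j0.
suff -> : it (i + j).+1 i j = naive_step (fun i j => it (i + j).+1 i j) i j.
  by split=> /naive_stepP.
by apply: eq_naive_step => // i' j' i'0 j'0 lt; apply: stable.
Qed.

End ExistenceUniqueness.

(* Main.v *)
Require Import Defs.
From Stdlib Require Import PeanoNat.
From mathcomp Require Import all_boot.
From mathcomp Require Import zify.

(** The nonzero numbers below [2 ^ (n + 1)], with Nim addition, are the points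
    of the projective space PG(n, 2), whose lines are the triples
    [{a, b, a ⊕ b}]: two distinct points lie on exactly one line, each point
    lies on [2 ^ n - 1] lines, and there are [d] lines ([points_eq_line],
    [exists_line], [lines_through], [size_lines]).  A naive matrix writes down
    these lines in the lexicographic order of their pairs [a < b] of smallest
    points.

    By induction, suppose that the rows before row [i] are the lines before
    the line [p = {a, b, a ⊕ b}], where [a < b < a ⊕ b].  Then

    - a point of [p] is free: a row meeting [p] in two points would be [p], and
      its column is not full, [p] being one more line through it;
    - a point below [a] has a full column, all lines through it being earlier;
    - a point [x] with [a < x < b] is blocked by the line through [a] and [x],
      which is earlier;
    - a point [x] with [b < x < a ⊕ b] is blocked by a line through [a] or
      through [b].  This is the property that defines Nim addition: [a ⊕ b]
      is the least number different from all [a' ⊕ b], [a' < a], and all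
      [a ⊕ b'], [b' < b] ([ltn_nim]).  So [x] is one of those, and the
      line [{a', b, x}] or [{a, b', x}] is earlier than [p];
    - a point beyond [a ⊕ b] meets the bound [3] on the row sum. *)

Set Implicit Arguments.
Unset Strict Implicit.
Unset Printing Implicit Defensive.

Local Notation "a ⊕ b" := (Nat.lxor a b) (at level 50, left associativity).

(** * Nim addition *)

Lemma nimK a b : a ⊕ (a ⊕ b) = b.
Proof. by rewrite -Nat.lxor_assoc Nat.lxor_nilpotent Nat.lxor_0_l. Qed.

Lemma nimKr a b : a ⊕ b ⊕ b = a.
Proof. by rewrite Nat.lxor_assoc Nat.lxor_nilpotent Nat.lxor_0_r. Qed.

Lemma nim_half a b : (a ⊕ b)./2 = a./2 ⊕ b./2.
Proof.
have E x : x./2 = Nat.shiftr x 1.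
  by rewrite -Nat.div2_spec; have := Nat.div2_odd x; case: Nat.odd => /=; lia.
by rewrite !E Nat.shiftr_lxor.
Qed.

Lemma nim_odd a b : odd (a ⊕ b) = odd a (+) odd b.
Proof.
have E x : odd x = Nat.testbit x 0.
  rewrite Nat.bit0_odd; elim: x => //= x ->.
  by rewrite Nat.odd_succ Nat.negb_odd.
by rewrite !E Nat.lxor_spec; do 2!case: (Nat.testbit _ 0).
Qed.

Lemma nim_lt_exp2 m a b : a < 2 ^ m -> b < 2 ^ m -> a ⊕ b < 2 ^ m.
Proof.
elim: m a b => [|m IH] a b; first by case: a; case: b.
rewrite expnS => ltam ltbm.
have := IH a./2 b./2; rewrite -nim_half; lia.
Qed.

(** At the highest binary digit where [x] and [a ⊕ b] differ, [x] has [0] and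
    exactly one of [a], [b] has [1]; this one gets smaller when [x ⊕ a ⊕ b] is
    added to it.  The induction strips off the last digit. *)
Lemma ltn_nim a b x : x < a ⊕ b -> (a ⊕ x < b) || (b ⊕ x < a).
Proof.
have [m] := ubnP (a + b); elim: m a b x => // m IH a b x ltm ltx.
have [ab0 | ab0] := posnP (a + b).
  have [a0 b0] : a = 0 /\ b = 0 by lia.
  by rewrite a0 b0 in ltx.
have half_lt u v : u./2 < v./2 -> u < v.
  by apply: contraLR; rewrite -!leqNgt; exact: half_leq.
have [lth|leh] := ltnP x./2 (a ⊕ b)./2.
  rewrite nim_half in lth.
  have ltm' : a./2 + b./2 < m by lia.
  by have /orP[lt|lt] := IH _ _ _ ltm' lth; rewrite -nim_half in lt;
    rewrite (half_lt _ _ lt) ?orbT.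
have eh : x./2 = (a ⊕ b)./2.
  by apply/eqP; rewrite eqn_leq leh half_leq // ltnW.
have ha : (a ⊕ x)./2 = b./2 by rewrite nim_half eh nim_half nimK.
have hb : (b ⊕ x)./2 = a./2.
  by rewrite nim_half eh nim_half (Nat.lxor_comm a./2) nimK.
have [ox oab] : odd x = false /\ odd (a ⊕ b).
  move: ltx; rewrite -{1}(odd_double_half x) -{1}(odd_double_half (a ⊕ b)) eh.
  by rewrite ltn_add2r; case: odd; case: odd.
have lt_odd u v : u./2 = v./2 -> ~~ odd u -> odd v -> u < v.
  move=> h ou ov; rewrite -[u]odd_double_half -[v]odd_double_half h.
  by rewrite (negbTE ou) ov.
have oax := nim_odd a x; have obx := nim_odd b x.
rewrite nim_odd in oab; rewrite ox addbF in oax; rewrite ox addbF in obx.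
case oa: (odd a) oab oax => /= oab oax.
  by rewrite (lt_odd _ _ hb) ?orbT // obx -[odd b]negbK oab.
by rewrite (lt_odd _ _ ha) // oax.
Qed.

(** * Lines of the projective space *)

(** A line is given by its two smallest points. *)
Definition points (p : nat * nat) : seq nat := [:: p.1; p.2; p.1 ⊕ p.2].

Definition is_line (m : nat) (p : nat * nat) : bool :=
  [&& 0 < p.1, p.1 < p.2, p.2 < p.1 ⊕ p.2 & p.1 ⊕ p.2 < 2 ^ m].

Lemma points_line p x y : x \in points p -> y \in points p -> x != y ->
  points p =i [:: x; y; x ⊕ y].
Proof.
case: p => a b; rewrite /points !inE /=.
by case/or3P=> /eqP-> /or3P[] /eqP-> nxy z; rewrite ?eqxx // in nxy *;
  rewrite ?(Nat.lxor_comm b a) ?nimK ?nimKr ?(Nat.lxor_comm (a ⊕ b)) ?nimK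
    ?(Nat.lxor_comm a b) ?nimK !inE ?(Nat.lxor_comm b (a ⊕ b)) ?nimKr; lia.
Qed.

Lemma points_sorted m p : is_line m p -> sorted ltn (points p).
Proof. by case/and4P=> _ h1 h2 _ /=; rewrite h1 h2. Qed.

Lemma points_bound m p x : is_line m p -> x \in points p -> 0 < x < 2 ^ m.
Proof. by rewrite /is_line /points !inE; lia. Qed.

Lemma points_eq_line m p q x y : is_line m p -> is_line m q -> x != y ->
  x \in points p -> y \in points p -> x \in points q -> y \in points q ->
  p = q.
Proof.
move=> lp lq nxy xp yp xq yq.
have : points p = points q.
  apply: (irr_sorted_eq ltn_trans ltnn) (points_sorted lp) (points_sorted lq) _.
  by move=> z; rewrite (points_line xp yp nxy) (points_line xq yq nxy).
by case: p q {lp lq xp yp xq yq} => [a b] [c d] [-> ->].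
Qed.

Lemma exists_line m x y : 0 < x < 2 ^ m -> 0 < y < 2 ^ m -> x != y ->
  exists2 p, is_line m p & (x \in points p) && (y \in points p).
Proof.
wlog ltxy: x y / x < y => [W hx hy nxy|].
  have [lt|lt|E] := ltngtP x y; [exact: W | | by rewrite E eqxx in nxy].
  have [|p lp xyp] := W y x lt hy hx; first by rewrite eq_sym.
  by exists p; rewrite // andbC.
move=> hx hy _.
have zm : x ⊕ y < 2 ^ m by apply: nim_lt_exp2; lia.
have z0 : x ⊕ y != 0 by apply/eqP => /Nat.lxor_eq; lia.
have zx : x ⊕ y != x.
  by apply/eqP => E; have := nimK x y; rewrite E Nat.lxor_nilpotent; lia.
have zy : x ⊕ y != y.
  by apply/eqP => E; have := nimKr x y; rewrite E Nat.lxor_nilpotent; lia.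
have E1 := nimK x y.
have E2 : x ⊕ y ⊕ x = y by rewrite Nat.lxor_comm nimK.
have [lt1|lt1] := ltnP (x ⊕ y) x.
  by exists (x ⊕ y, x); rewrite /is_line /points /= ?inE E2; lia.
have [lt2|lt2] := ltnP (x ⊕ y) y.
  by exists (x, x ⊕ y); rewrite /is_line /points /= ?inE E1; lia.
by exists (x, y); rewrite /is_line /points /= ?inE; lia.
Qed.

(** * The lines in lexicographic order *)

Definition lexle (p q : nat * nat) : bool :=
  (p.1 < q.1) || (p.1 == q.1) && (p.2 <= q.2).

Lemma lexle_total : total lexle.
Proof. by move=> p q; rewrite /lexle; lia. Qed.

Lemma lexle_trans : transitive lexle.
Proof. by move=> q p r; rewrite /lexle; lia. Qed.

Definition lines (m : nat) : seq (nat * nat) :=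
  sort lexle [seq p <- [seq (a, b) | a <- iota 0 (2 ^ m), b <- iota 0 (2 ^ m)]
             | is_line m p].

Lemma mem_lines m p : (p \in lines m) = is_line m p.
Proof.
rewrite mem_sort mem_filter; have [lp|//] := boolP (is_line m p).
apply/allpairsP; exists p; rewrite !mem_iota.
by case: p lp => a b; rewrite /is_line /=; split=> //; lia.
Qed.

Lemma uniq_lines m : uniq (lines m).
Proof.
rewrite sort_uniq filter_uniq // allpairs_uniq ?iota_uniq //.
by move=> [a b] [c d] _ _ /= ->.
Qed.

Lemma mem_take_lines m t q : t < size (lines m) -> q \in lines m ->
  ~~ lexle (nth (0, 0) (lines m) t) q -> q \in take t (lines m).
Proof.
move=> ltt qL; rewrite in_take //; apply: contraR; rewrite -leqNgt => le_t.
rewrite -[q in lexle _ q](nth_index (0, 0) qL).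
apply: (sorted_leq_nth lexle_trans) => //; last by rewrite inE index_mem.
- by move=> p; rewrite /lexle; lia.
- exact: sort_sorted lexle_total _.
Qed.

Lemma nth_notin_take m t : t < size (lines m) ->
  nth (0, 0) (lines m) t \notin take t (lines m).
Proof.
by move=> ltt; rewrite in_take ?mem_nth // index_uniq ?uniq_lines // ltnn.
Qed.

(** * Counting lines *)

Lemma sum_mem (lo hi : nat) (s : seq nat) : uniq s ->
  {in s, forall x, lo <= x < hi} ->
  \sum_(lo <= x < hi) (x \in s) = size s.
Proof.
move=> us sub; rewrite -big_mkcond sum1_count -size_filter.
apply/perm_size/uniq_perm; rewrite ?filter_uniq ?iota_uniq //.
move=> x; rewrite mem_filter mem_index_iota; apply: andb_idr.
exact: sub.
Qed.

Lemma sum_points m p : is_line m p ->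
  \sum_(1 <= x < 2 ^ m) (x \in points p) = 3.
Proof.
move=> lp; rewrite sum_mem //.
  by apply: sorted_uniq (points_sorted lp); [exact: ltn_trans | exact: ltnn].
by move=> x /(points_bound lp).
Qed.

(** Double count of the incidences of a point [x] with a line through [j]:
    each such line has three points, every [x != j] is on one of these lines,
    and [j] is on all of them. *)
Lemma lines_through n j : 0 < j < 2 ^ n.+1 ->
  count (fun p => j \in points p) (lines n.+1) = 2 ^ n - 1.
Proof.
move=> hj; set c := count _ _.
have jI : j \in index_iota 1 (2 ^ n.+1) by rewrite mem_index_iota.
have E3 : \sum_(1 <= x < 2 ^ n.+1)
    count (fun p => (j \in points p) && (x \in points p)) (lines n.+1) = 3 * c.
  under eq_bigr => x _ do rewrite -sum1_count big_mkcond.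
  rewrite exchange_big /= /c -sum1_count [in RHS]big_mkcond big_distrr /=.
  apply: eq_big_seq => p; rewrite mem_lines => lp.
  case: (j \in points p) => /=; last by rewrite big1.
  by rewrite -[RHS](sum_points lp); apply: eq_bigr => x _; case: (x \in _).
have E1 : \sum_(1 <= x < 2 ^ n.+1) 1 = 2 ^ n.+1 - 1.
  by rewrite sum_nat_const_nat muln1.
move: E3 E1; rewrite !(bigD1_seq j jI (iota_uniq _ _)) /=.
rewrite (eq_count (a2 := fun p => j \in points p)) => [|p]; last exact: andbb.
rewrite big_seq_cond (eq_bigr (fun=> 1)) => [|x /andP[]]; last first.
  rewrite mem_index_iota => hx nxj.
  have [|p lp /andP[jp xp]] := exists_line hj hx; first by rewrite eq_sym.
  rewrite (eq_in_count (a2 := pred1 p)) => [|q]; last first.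
    rewrite mem_lines => lq /=; apply/andP/eqP => [[jq xq]|-> //].
    exact: points_eq_line lq lp nxj xq jq xp jp.
  by rewrite count_uniq_mem ?uniq_lines // mem_lines lp.
rewrite -big_seq_cond expnS -/c; move: (\sum_(i <- _ | _) 1) => S; lia.
Qed.

(** Each line is counted at each of its three points. *)
Lemma size_lines n :
  size (lines n.+1) = ((2 ^ n.+1 - 1) * (2 ^ n - 1)) %/ 3.
Proof.
suff -> : (2 ^ n.+1 - 1) * (2 ^ n - 1) = size (lines n.+1) * 3 by rewrite mulnK.
rewrite -sum_nat_const_nat -sum1_size big_distrl /=.
rewrite (eq_big_nat _ _ (fun j hj => esym (lines_through hj))).
under eq_bigr => j _ do rewrite -sum1_count big_mkcond.
rewrite exchange_big /=; apply: eq_big_seq => p; rewrite mem_lines => lp.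
by rewrite mul1n -(sum_points lp); apply: eq_bigr => x _; case: (x \in _).
Qed.

(** * The greedy choice of a line *)

Lemma smaller_point_before m p q z : is_line m q ->
  z \in points q -> z < p.1 -> ~~ lexle p q.
Proof.
by case: p q => [a b] [c d]; rewrite /is_line /points /lexle !inE /=; lia.
Qed.

Lemma smaller_second_before m p q z : is_line m q ->
  p.1 \in points q -> z \in points q -> z != p.1 -> z < p.2 -> ~~ lexle p q.
Proof.
by case: p q => [a b] [c d]; rewrite /is_line /points /lexle !inE /=; lia.
Qed.

(** Below the second point of [p] the line through [p.1] and [x] will do.
    Above it, [ltn_nim] provides a line through [p.1] or [p.2] whose third
    point is so small that this line comes before [p]. *)
Lemma blocked_by_earlier_line m p x : is_line m p ->
  p.1 < x < p.1 ⊕ p.2 -> x \notin points p ->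
  exists y q, [/\ y \in points p, 0 < y < x, is_line m q, ~~ lexle p q
                & (y \in points q) && (x \in points q)].
Proof.
move=> lp hx xp.
have hp1 : 0 < p.1 < 2 ^ m by apply: (points_bound lp); rewrite !inE eqxx.
have hp2 : 0 < p.2 < 2 ^ m.
  by apply: (points_bound lp); rewrite !inE eqxx orbT.
have hp3 : p.1 ⊕ p.2 < 2 ^ m by case/and4P: lp.
have hxm : 0 < x < 2 ^ m by lia.
have np1x : p.1 != x by lia.
have [q1 lq1 /andP[pq1 xq1]] := exists_line hp1 hxm np1x.
have via1 z : z \in points q1 -> z != p.1 -> z < p.2 ->
    exists y q, [/\ y \in points p, 0 < y < x, is_line m q, ~~ lexle p q
                  & (y \in points q) && (x \in points q)].
  move=> zq nz ltz; exists p.1, q1; split=> //; try lia.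
  - by rewrite !inE eqxx.
  - exact: smaller_second_before lq1 pq1 zq nz ltz.
  - by rewrite pq1.
have nxp2 : p.2 != x by apply: contraNneq xp => <-; rewrite !inE eqxx orbT.
have [ltx|lex] := ltnP x p.2; first by apply: (via1 x); rewrite // eq_sym.
have /orP[lt|lt] : (p.1 ⊕ x < p.2) || (p.2 ⊕ x < p.1) by apply: ltn_nim; lia.
  apply: (via1 (p.1 ⊕ x)) => //.
    by rewrite (points_line pq1 xq1 np1x) !inE eqxx !orbT.
  by apply/eqP => E; have := nimK p.1 x; rewrite E Nat.lxor_nilpotent; lia.
have [q lq /andP[pq xq]] := exists_line hp2 hxm nxp2.
exists p.2, q; split=> //; try lia.
- by rewrite !inE eqxx orbT.
- apply: smaller_point_before lq _ lt.
  by rewrite (points_line pq xq nxp2) !inE eqxx !orbT.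
- by rewrite pq.
Qed.

Lemma column_full m t x : t < size (lines m) ->
  x < (nth (0, 0) (lines m) t).1 ->
  count (fun q => x \in points q) (lines m)
    <= count (fun q => x \in points q) (take t (lines m)).
Proof.
move=> ltt ltx; rewrite -!size_filter uniq_leq_size ?filter_uniq ?uniq_lines //.
move=> q; rewrite !mem_filter => /andP[xq qL]; rewrite xq /=.
apply: mem_take_lines => //; rewrite mem_lines in qL.
exact: smaller_point_before qL xq ltx.
Qed.

Lemma column_not_full m t x : t < size (lines m) ->
  x \in points (nth (0, 0) (lines m) t) ->
  count (fun q => x \in points q) (take t (lines m))
    < count (fun q => x \in points q) (lines m).
Proof.
move=> ltt xp; rewrite -[in X in _ < X](cat_take_drop t (lines m)) count_cat.
by rewrite (drop_nth (0, 0) ltt) /= xp addnS ltnS leq_addr.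
Qed.

Lemma row_sum m p x : is_line m p ->
  \sum_(1 <= y < x) (y \in points p) = count (fun y => y < x) (points p).
Proof.
move=> lp; rewrite -size_filter -(@sum_mem 1 x).
- by apply: eq_big_nat => y /andP[_ ltyx]; rewrite mem_filter ltyx.
- apply/filter_uniq/(sorted_uniq ltn_trans ltnn); exact: points_sorted lp.
- by move=> y; rewrite mem_filter => /andP[-> /(points_bound lp)/andP[->]].
Qed.

Lemma column_sum (A : nat -> nat -> bool) (L : seq (nat * nat)) t x :
  t <= size L ->
  (forall s, s < t -> A s.+1 x = (x \in points (nth (0, 0) L s))) ->
  \sum_(1 <= i < t.+1) A i x = count (fun q => x \in points q) (take t L).
Proof.
move=> let_ rows; rewrite big_add1 -sum1_count [in RHS]big_mkcond /=.
rewrite (big_nth (0, 0)) size_takel //; apply: eq_big_nat => s /andP[_ lts].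
by rewrite nth_take // rows //; case: (x \in _).
Qed.

(** Whether column [x] belongs to the row depends on the earlier entries of the
    same row, in the first two obstructions; so the claim is proved by a second
    induction, on [x]. *)
Lemma next_row n (A : nat -> nat -> bool) t :
  naive_matrix 3 (2 ^ n - 1) A -> t < size (lines n.+1) ->
  (forall s x, s < t -> 0 < x ->
     A s.+1 x = (x \in points (nth (0, 0) (lines n.+1) s))) ->
  forall x, 0 < x -> A t.+1 x = (x \in points (nth (0, 0) (lines n.+1) t)).
Proof.
set L := lines _; set p := nth _ _ t => hA ltt rows x.
have lp : is_line n.+1 p by rewrite -mem_lines mem_nth.
have [k] := ubnP x; elim: k x => // k IH x ltxk x0.
have rowx y : 0 < y < x -> A t.+1 y = (y \in points p).
  by case/andP=> y0 ltyx; apply: IH => //; apply: leq_trans ltyx ltxk.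
have csum : \sum_(1 <= i' < t.+1) A i' x
    = count (fun q => x \in points q) (take t L).
  by apply: column_sum (ltnW ltt) _ => s lts; exact: rows.
have rsum : \sum_(1 <= j' < x) A t.+1 j' = count (fun y => y < x) (points p).
  by rewrite -(row_sum _ lp); apply: eq_big_nat => y hy; rewrite rowx.
have [h1 h2 h3] : [/\ 0 < p.1, p.1 < p.2 & p.2 < p.1 ⊕ p.2].
  by case/and4P: lp.
apply/idP/idP => [Atx | xp].
- have [//|xp] := boolP (x \in points p).
  case: ((hA t.+1 x isT x0).1 Atx).
  have [gtx|lex] := ltnP (p.1 ⊕ p.2) x.
    by apply: Or32; rewrite rsum /= gtx (ltn_trans h3 gtx)
      (ltn_trans h2 (ltn_trans h3 gtx)).
  have [ltx|gex] := ltnP x p.1.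
    apply: Or33; rewrite csum -(@lines_through n x).
      exact: column_full ltt ltx.
    have : p.1 \in points p by rewrite inE eqxx.
    by move=> /(points_bound lp)/andP[_ /(ltn_trans ltx)->]; rewrite x0.
  have hx : p.1 < x < p.1 ⊕ p.2 by move: xp; rewrite !inE; lia.
  have [y [q [yp /andP[y0 ltyx] lq bq /andP[yq xq]]]] :=
    blocked_by_earlier_line lp hx xp.
  have qT : q \in take t L by rewrite mem_take_lines ?mem_lines.
  have qL : q \in L by rewrite mem_lines.
  have qt : index q L < t by rewrite -in_take.
  apply: Or31; exists (index q L).+1, y; split; rewrite ?ltnS ?y0 //.
  + by rewrite rowx // y0.
  + by rewrite rows // nth_index.
  + by rewrite rows // nth_index.
- apply/(hA t.+1 x isT x0) => -[[s' [y []]]||].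
  + case: s' => [//|s] lts /andP[y0 ltyx] Aty Asx Asy.
    have {}lts : s < t by [].
    rewrite rowx ?y0 // in Aty; rewrite !rows // in Asx Asy.
    have ls : is_line n.+1 (nth (0, 0) L s).
      by rewrite -mem_lines mem_nth // (ltn_trans lts).
    have nyx : y != x by rewrite ltn_eqF.
    have /eqP := points_eq_line ls lp nyx Asy Asx Aty xp.
    by rewrite nth_uniq ?uniq_lines ?(ltn_trans lts) // ltn_eqF.
  + (* Three points of [p] below [x] would be all of them, but [x] is one. *)
    rewrite rsum leqNgt => /negP[]; rewrite -[3]/(size (points p)).
    rewrite ltn_neqAle count_size andbT -all_count; apply/allPn; exists x => //.
    by rewrite ltnn.
  + rewrite csum leqNgt => /negP[]; rewrite -(@lines_through n x).
      exact: column_not_full ltt xp.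
    exact: points_bound lp xp.
Qed.

Theorem mainTheorem1 (n : nat) (hn : 1 <= n) (A : nat -> nat -> bool)
    (hA : naive_matrix 3 (2 ^ n - 1) A) (i : nat)
    (hi : 1 <= i <= ((2 ^ (n + 1) - 1) * (2 ^ n - 1)) %/ 3) :
  exists a b : nat,
    [/\ 0 < a, a < b, b < Nat.lxor a b, Nat.lxor a b < 2 ^ (n + 1)
      & row_support A i =i [:: a; b; Nat.lxor a b]].
Proof.
move: hi; rewrite addn1 -size_lines; case: i => [//|t] /= ltt.
have rowt : forall x, 0 < x ->
    A t.+1 x = (x \in points (nth (0, 0) (lines n.+1) t)).
  elim/ltn_ind: t ltt => t IH ltt.
  by apply: (next_row hA ltt) => s x lts; apply: IH lts (ltn_trans lts ltt) x.
set p := nth _ _ t in rowt.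
have lp : is_line n.+1 p by rewrite -mem_lines mem_nth.
exists p.1, p.2; have /and4P[p1 p12 p23 p3] := lp; split=> // x.
rewrite unfold_in /=; have [x0|x0] := posnP x; last exact: rowt.
apply/esym/negbTE/negP => xp.
by have := points_bound lp xp; rewrite x0.
Qed.
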